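(* Let $q$ be a prime power, $e>1$ an integer dividing $q-1$, and $I\subseteq\{0,1,\ldots,e-1\}$. Let $\gamma$ be a primitive element of $\mathbb{F}_{q^2}$, $\omega=\mathrm{Norm}_{q^2/q}(\gamma)=\gamma^{q+1}$, $C_i^{(e,q^2)}=\gamma^i\langle\gamma^e\rangle$ and $C_i^{(e,q)}=\omega^i\langle\omega^e\rangle$ for $0\le i\le e-1$, and $E=\bigcup_{i\in I}C_i^{(e,q)}\subseteq\mathbb{F}_q^\ast$. Assume that $\mathrm{Cay}(\mathbb{F}_{q^2},\bigcup_{i\in I}C_i^{(e,q^2)})$ is a strongly regular graph of negative Latin square type. Then for every positive integer $m$ and every nonsingular quadratic form $Q:V=\mathbb{F}_q^{2m}\to\mathbb{F}_q$, the Cayley graph $\mathrm{Cay}(V,D_E)$, where $D_E=\{x\in V: Q(x)\in E\}$, is strongly regular.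
   Context: A Cayley graph $\mathrm{Cay}(G,D)$ on an additive abelian group $G$ with $0\notin D=-D$ has vertex set $G$ and $x\sim y$ iff $x-y\in D$. A strongly regular graph with parameters $(v,k,\lambda,\mu)$ is of negative Latin square type if $(v,k,\lambda,\mu)=(n^2,r(n+1),-n+r^2+3r,r^2+r)$ for some $n,r$. A quadratic form $Q$ on $V$ satisfies $Q(\alpha v)=\alpha^2Q(v)$ and $B(u,v)=Q(u+v)-Q(u)-Q(v)$ is bilinear; it is nonsingular if it cannot be written in fewer than $\dim V$ variables after an invertible linear change of variables. *)

(* Defs.v *)
From HB Require Import structures.
From mathcomp Require Import all_boot all_order all_algebra all_field.

Set Implicit Arguments.
Unset Strict Implicit.
Unset Printing Implicit Defensive.

Import GRing.Theory.
Local Open Scope ring_scope.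

(* Complete and edgeless graphs are not counted as strongly regular. *)
Record is_srg (T : finType) (adj : rel T) (v k lam mu : nat) : Prop := IsSrg {
  srg_sym : symmetric adj;
  srg_irr : irreflexive adj;
  srg_not_edgeless : exists x y : T, adj x y;
  srg_not_complete : exists x y : T, x != y /\ ~~ adj x y;
  srg_order : #|T| = v;
  srg_valency : forall x : T, #|[set y | adj x y]| = k;
  srg_adjacent : forall x y : T, adj x y ->
    #|[set z | adj x z && adj y z]| = lam;
  srg_nonadjacent : forall x y : T, x != y -> ~~ adj x y ->
    #|[set z | adj x z && adj y z]| = mu
}.

Definition strongly_regular (T : finType) (adj : rel T) : Prop :=
  exists v k lam mu : nat, is_srg adj v k lam mu.

(* [n] and [r] must be nonnegative: the substitution (n, r) -> (-n, -r) turns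
   these parameters into those of (positive) Latin square type. *)
Definition negative_latin_square_type (T : finType) (adj : rel T) : Prop :=
  exists n r v k lam mu : nat,
    [/\ is_srg adj v k lam mu,
        v = (n ^ 2)%N,
        k = (r * (n + 1))%N,
        lam%:Z = - n%:Z + r%:Z ^+ 2 + 3%:Z * r%:Z
      & mu = (r ^ 2 + r)%N].

(* The conditions 0 \notin D and D = -D say that this relation is irreflexive
   and symmetric, which is part of [is_srg]. *)
Definition cayley (G : finZmodType) (D : {set G}) : rel G :=
  fun x y => x - y \in D.

(* The coset g^i <g^e>; for g != 0 the powers of g^e are periodic with period
   dividing #|K| - 1, so the exponents j < #|K| give all of <g^e>. *)
Definition cyclotomic_class (K : finFieldType) (g : K) (e i : nat) : {set K} :=
  [set g ^+ i * (g ^+ e) ^+ j | j : 'I_#|K|].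

Definition polar_form (F : fieldType) (n : nat) (Q : 'rV[F]_n -> F)
    (u v : 'rV[F]_n) : F :=
  Q (u + v) - Q u - Q v.

Definition quadratic_form (F : fieldType) (n : nat) (Q : 'rV[F]_n -> F) : Prop :=
  [/\ forall (a : F) (v : 'rV[F]_n), Q (a *: v) = a ^+ 2 * Q v,
      forall u : 'rV[F]_n, scalar (polar_form Q u)
    & forall v : 'rV[F]_n, scalar (fun u => polar_form Q u v)].

(* After the change of variables [A], [Q] is a form [Q'] in the first [k]
   coordinates only. *)
Definition nonsingular (F : fieldType) (n : nat) (Q : 'rV[F]_n -> F) : Prop :=
  ~ exists (k : nat) (ltkn : (k < n)%N) (A : 'M[F]_n) (Q' : 'rV[F]_k -> F),
      [/\ A \in unitmx,
          quadratic_form Q'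
        & forall x : 'rV[F]_n,
            Q (x *m A) = Q' (colsub (widen_ord (ltnW ltkn)) x)].

(* Main.v *)
Require Import Defs.
From HB Require Import structures.
From mathcomp Require Import all_boot all_order all_algebra.
From mathcomp Require Import all_fingroup all_solvable all_field.
From mathcomp Require Import ring zify.

(* Let B be the polar form of Q.  In even dimension #{u | Q u = c} is the same
   number z1 for all c <> 0: in characteristic 2 every scalar is a square, and
   otherwise an orthogonal splitting into planes reduces this to the fact that
   x^2 + k y^2 represents every scalar.
   Fix d <> 0.  For each slope w, the u with (Q u, B(u, d)) on the line
   {(c, t) | c + w t = a + w s} are those with Q (u + w d) = a + w s + w^2 Q d,
   so summing over the pencil of lines through (a, s) expresses
   #{u | Q u = a, B(u, d) = s} by #V, #{u | Q u = 0}, z1 and the number of roots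
   w of a + w s + w^2 Q d.  Taking s = b - a - Q d and summing over a, b in E,
   the number of common neighbours of x and x + d in Cay(V, D_E) becomes an
   affine function of root_count E (Q d), a quantity that depends on F, E and
   Q d only.
   The norm K -> F is such a form, and its graph is the given Cayley graph on K:
   strong regularity there says that root_count E is constant on E and on the
   nonzero scalars outside E.  The scalar 0, which the norm takes only at 0 but Q
   may take elsewhere, has root_count E 0 = |E|^2 - |E|; the value
   mu = r^2 + r with r = |E| of a negative Latin square type is exactly what
   makes it agree with the second constant. *)

Set Implicit Arguments.
Unset Strict Implicit.
Unset Printing Implicit Defensive.

Import GRing.Theory.
Local Open Scope ring_scope.

(** * Counting preliminaries and the order of a finite field *)

Lemma card_setE (T : finType) (P : pred T) :
  #|[set x | P x]| = (\sum_x P x)%N.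
Proof. by rewrite -sum1dep_card big_mkcond. Qed.

Lemma card_finField_pnat (F : finFieldType) (n : nat) :
  #|F| = n -> [pchar F].-nat n.
Proof.
move=> <-; have [p p_pr charFp] := finPcharP F.
have /abelem_pgroup := fin_ring_pchar_abelem charFp.
by rewrite /pgroup cardsT -(eq_pnat _ (pcharf_eq charFp)).
Qed.

Lemma odd_card_finField (F : finFieldType) : (2%:R : F) != 0 -> odd #|F|.
Proof.
move=> nz2; have [p p_pr charFp] := finPcharP F.
have := card_finField_pnat (erefl #|F|).
rewrite (eq_pnat _ (pcharf_eq charFp)) => /p_natP [n ->].
rewrite oddX; apply/orP; right.
case: (even_prime p_pr) => // p2; move: charFp; rewrite p2 => /pcharf0 E.
by rewrite E eqxx in nz2.
Qed.

(** * Values of binary quadratic forms in odd characteristic *)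

Section BinaryForms.

Variable F : finFieldType.
Implicit Types k N a b c x y : F.

(** The map is at most two-to-one, so its image has at least half the elements of [F]; equality is
    excluded by parity. *)
Lemma card_affine_squares a b : odd #|F| -> a != 0 ->
  (#|F| < 2 * #|[set (b + a * x ^+ 2)%R | x : F]|)%N.
Proof.
move=> oddF a0; set S := [set _ | _ in _].
suff: (#|F| <= 2 * #|S|)%N.
  by rewrite leq_eqVlt => /predU1P [E|//]; move: oddF; rewrite E oddM.
rewrite -[#|F|]sum1_card.
rewrite (partition_big (fun x => b + a * x ^+ 2) (mem S)); last first.
  by move=> x _; apply: imset_f.
rewrite mulnC -sum_nat_const; apply: leq_sum => y /imsetP [x _ ->].
rewrite sum1dep_card; apply: leq_trans (_ : #|[set x; - x]| <= 2)%N.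
  apply/subset_leq_card/subsetP => z; rewrite !inE /=.
  by rewrite (inj_eq (addrI b)) (inj_eq (mulfI a0)) eqf_sqr.
by rewrite cards2; case: eqP.
Qed.

(** Pigeonhole: the squares and the values [N - k * y ^+ 2] each fill more than half of [F], so they
    meet. *)
Lemma sqr_add_mul_sqr_surj k N : (2%:R : F) != 0 -> k != 0 ->
  exists x y, x ^+ 2 + k * y ^+ 2 = N.
Proof.
move=> nz2 k0; have oddF := odd_card_finField nz2.
have nk0 : - k != 0 by rewrite oppr_eq0.
have := card_affine_squares 0 oddF (oner_neq0 F).
have := card_affine_squares N oddF nk0.
set S := [set _ | _ in _]; set T := [set _ | _ in _] => hS hT.
have [|/pred0Pn [_ /andP [/= /imsetP [y _ ->] /imsetP [x _ E]]]] :=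
  boolP [disjoint S & T].
  rewrite -leq_card_setU => /eqP E.
  have := max_card (mem (S :|: T)); rewrite E.
  by move: #|S| #|T| #|F| hS hT => i j n; lia.
exists x, y; move: E; rewrite add0r mul1r => <-; ring.
Qed.

(* Brahmagupta's identity: multiplication by x^2 + a b y^2 on the values of
   a s^2 + b t^2 is induced by an invertible substitution in (s, t). *)
Lemma sum_binary_form_scale (a b N : F) (f : F -> nat) :
  (2%:R : F) != 0 -> a != 0 -> b != 0 -> N != 0 ->
  (\sum_s \sum_t f (a * s ^+ 2 + b * t ^+ 2)%R =
   \sum_s \sum_t f (N * (a * s ^+ 2 + b * t ^+ 2))%R)%N.
Proof.
move=> nz2 a0 b0 N0.
have [x [y E]] := sqr_add_mul_sqr_surj N nz2 (mulf_neq0 a0 b0).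
rewrite !pair_bigA /=.
pose phi (p : F * F) := (p.1 * x - b * p.2 * y, p.2 * x + a * p.1 * y).
(* The substitution [phi] has determinant [x ^+ 2 + a * b * y ^+ 2 = N]; [psi] is its inverse by
   Cramer's rule. *)
pose psi (p : F * F) :=
  ((p.1 * x + b * p.2 * y) / N, (p.2 * x - a * p.1 * y) / N).
have phiK : cancel phi psi.
  move=> [s t]; rewrite /phi /psi -E /=; rewrite -E in N0.
  by congr (_, _); field.
rewrite (reindex_inj (can_inj phiK)) /=; apply: eq_bigr => -[s t] _ /=.
by congr f; rewrite -E; ring.
Qed.

End BinaryForms.

(** * Quadratic maps on arbitrary modules, to cover row vectors and [K] over [F] alike *)

Definition polar (F : fieldType) (V : lmodType F) (Q : V -> F) (u v : V) : F :=
  Q (u + v) - Q u - Q v.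

Record quadratic_map (F : fieldType) (V : lmodType F) (Q : V -> F) : Prop :=
  QuadraticMap {
    quadraticZ : forall (a : F) (v : V), Q (a *: v) = a ^+ 2 * Q v;
    polar_scalar : forall u : V, scalar (polar Q u)
  }.

Section QuadraticMap.

Variables (F : fieldType) (V : lmodType F) (Q : V -> F).
Hypothesis quadQ : quadratic_map Q.
Implicit Types (a b : F) (u v w : V).

Lemma polarC u v : polar Q u v = polar Q v u.
Proof. by rewrite /polar (addrC u) -!addrA (addrC (- Q u)). Qed.

Lemma polarDZr u a v w : polar Q u (a *: v + w) = a * polar Q u v + polar Q u w.
Proof. exact: polar_scalar. Qed.

Lemma polar0r u : polar Q u 0 = 0.
Proof. by have := polarDZr u (-1) 0 0; rewrite scaler0 addr0 mulN1r addNr. Qed.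

Lemma polarDr u v w : polar Q u (v + w) = polar Q u v + polar Q u w.
Proof. by have := polarDZr u 1 v w; rewrite scale1r mul1r. Qed.

Lemma polarZr u a v : polar Q u (a *: v) = a * polar Q u v.
Proof. by have := polarDZr u a v 0; rewrite polar0r !addr0. Qed.

Lemma polarDZl u a v w : polar Q (a *: v + w) u = a * polar Q v u + polar Q w u.
Proof. by rewrite !(polarC _ u) polarDZr. Qed.

Lemma polarDl u v w : polar Q (v + w) u = polar Q v u + polar Q w u.
Proof. by rewrite !(polarC _ u) polarDr. Qed.

Lemma polarZl u a v : polar Q (a *: v) u = a * polar Q v u.
Proof. by rewrite !(polarC _ u) polarZr. Qed.

Lemma quadratic0 : Q 0 = 0.
Proof. by rewrite -(scale0r 0) (quadraticZ quadQ) expr0n mul0r. Qed.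

Lemma quadraticN v : Q (- v) = Q v.
Proof. by rewrite -scaleN1r (quadraticZ quadQ) sqrrN expr1n mul1r. Qed.

Lemma quadraticD u v : Q (u + v) = Q u + Q v + polar Q u v.
Proof. by rewrite /polar; ring. Qed.

Lemma quadraticDZ a u v :
  Q (a *: u + v) = a ^+ 2 * Q u + Q v + a * polar Q u v.
Proof. by rewrite quadraticD (quadraticZ quadQ) polarZl. Qed.

Lemma polarvv v : polar Q v v = 2%:R * Q v.
Proof.
by rewrite /polar -[v + v]mulr2n -scaler_nat (quadraticZ quadQ); ring.
Qed.

End QuadraticMap.

(** Relative to a subset, so that inductions pass to orthogonal complements inside the same type
    [V]. *)
Definition nondegenerate_on (F : fieldType) (V : lmodType F) (Q : V -> F)
    (U : {pred V}) : Prop :=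
  forall v, v \in U -> {in U, forall u, polar Q u v = 0} -> v = 0.

(** * Level sets of nondegenerate quadratic maps over a finite field *)

Section Counting.

Variables (F : finFieldType) (V : finLmodType F) (Q : V -> F).
Hypothesis quadQ : quadratic_map Q.
Implicit Types (a b c s t w N : F) (u v d : V) (U : {set V}).

Definition perp U d := [set u in U | polar Q u d == 0].

Lemma perp_submod U d : submod_closed U -> submod_closed (perp U d).
Proof.
move=> [U0 UL]; split.
  by rewrite inE U0 polarC (polar0r quadQ) eqxx.
move=> a u v; rewrite !inE => /andP [uU /eqP ud] /andP [vU /eqP vd].
by rewrite UL //= (polarDZl quadQ) ud vd mulr0 addr0.
Qed.

(** As [polar Q d d = 2 Q d] is nonzero, [U] is the orthogonal sum of the line of [d] and
    [perp U d]; [t] is the coordinate along [d]. *)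
Lemma card_linear_fibres U (d : V) (P : pred V) :
  submod_closed U -> d \in U -> Q d != 0 -> (2%:R : F) != 0 ->
  #|[set u in U | P u]| =
  (\sum_t #|[set u in perp U d | P ((t : F) *: d + u)%R]|)%N.
Proof.
move=> [U0 UL] dU Qd nz2.
have dd0 : polar Q d d != 0 by rewrite (polarvv quadQ) mulf_neq0.
rewrite -sum1dep_card.
rewrite (partition_big (fun u => polar Q u d / polar Q d d) predT) //=.
apply: eq_bigr => t _.
rewrite (reindex_inj (addrI (t *: d))) -sum1dep_card; apply: eq_bigl => u.
rewrite !inE (polarDZl quadQ) mulrDl mulfK // -subr_eq0 (addrC t) addrK.
rewrite mulf_eq0 invr_eq0 (negPf dd0) orbF andbAC; congr (_ && _ && _).
apply/idP/idP => [h|]; last exact: UL.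
by rewrite -(addKr (t *: d) u) -scaleNr UL.
Qed.

(** Removing its component along [d] moves any [u] in [U] into [perp U d] without changing its
    pairing with [v]. *)
Lemma perp_nondegenerate U d :
  submod_closed U -> d \in U -> Q d != 0 -> (2%:R : F) != 0 ->
  nondegenerate_on Q U -> nondegenerate_on Q (perp U d).
Proof.
move=> [U0 UL] dU Qd nz2 ndU v; rewrite inE => /andP [vU /eqP vd] h.
have dd0 : polar Q d d != 0 by rewrite (polarvv quadQ) mulf_neq0.
apply: ndU => // u uU; rewrite -[u](addKr (- (polar Q u d / polar Q d d) *: d)).
rewrite -scaleNr opprK (polarDZl quadQ) (polarC _ d) vd mulr0 add0r h //.
by rewrite inE UL //= (polarDZl quadQ) mulNr divfK // addNr.
Qed.

(** If [Q] vanished on [U], so would its polar form, and nondegeneracy would leave only 0 in [U]. *)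
Lemma exists_anisotropic U :
  nondegenerate_on Q U -> submod_closed U -> (1 < #|U|)%N ->
  exists2 d, d \in U & Q d != 0.
Proof.
move=> ndU [U0 UL] /card_gt1P [x [y [xU yU nxy]]].
have [/exists_inP //|/exists_inPn h] := boolP [exists d in U, Q d != 0].
have Q0 : {in U, forall d, Q d = 0} by move=> d /h; rewrite negbK => /eqP.
have U_0 : {in U, forall v, v = 0}.
  move=> v vU; apply: ndU => // u uU.
  by rewrite /polar !Q0 ?subr0 // -[u]scale1r UL.
by rewrite (U_0 x xU) (U_0 y yU) eqxx in nxy.
Qed.

Lemma card_perp U d :
  submod_closed U -> d \in U -> Q d != 0 -> (2%:R : F) != 0 ->
  #|U| = (#|F| * #|perp U d|)%N.
Proof.
move=> subU dU Qd nz2.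
have := card_linear_fibres predT subU dU Qd nz2.
rewrite (_ : [set u in U | predT u] = U); last by apply/setP=> u; rewrite !inE andbT.
move=> ->; rewrite (eq_bigr (fun=> #|perp U d|)) ?sum_nat_const // => t _.
by apply: eq_card => u; rewrite !inE andbT.
Qed.

(** Induction on [n], splitting off two orthogonal anisotropic vectors: the binary form on their
    plane can be rescaled by [N], and the induction hypothesis rescales the complement. *)
Lemma level_card_scale_odd (n : nat) U N c :
  (2%:R : F) != 0 -> submod_closed U -> nondegenerate_on Q U ->
  #|U| = (#|F| ^ (2 * n))%N -> N != 0 ->
  #|[set u in U | Q u == N * c]| = #|[set u in U | Q u == c]|.
Proof.
move=> nz2 subU ndU cardU N0; elim: n U c subU ndU cardU => [|n IH] U c subU ndU.
  have [U0 _] := subU; rewrite muln0 => /eqP /cards1P [x Ux].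
  move: U0; rewrite Ux inE => /eqP x0; apply: eq_card => u.
  rewrite !inE -x0; case: eqP => //= ->; rewrite (quadratic0 quadQ).
  by rewrite !(eq_sym 0) mulf_eq0 (negPf N0).
have q_gt1 := finNzRing_gt1 F; have q_gt0 : (0 < #|F|)%N by apply: ltnW.
rewrite mulnS !addSn add0n !expnS => cardU.
have Fn_gt0 k : (0 < #|F| ^ k)%N by rewrite expn_gt0 q_gt0.
have [|d dU Qd] := exists_anisotropic ndU subU.
  by rewrite cardU (leq_trans q_gt1) // leq_pmulr // -expnS.
have subU1 := perp_submod d subU.
have ndU1 := perp_nondegenerate subU dU Qd nz2 ndU.
have := card_perp subU dU Qd nz2; rewrite cardU => /eqP.
rewrite eqn_pmul2l // => /eqP cardU1.
have [|d1 dU1 Qd1] := exists_anisotropic ndU1 subU1.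
  by rewrite -cardU1 (leq_trans q_gt1) // leq_pmulr.
have subU2 := perp_submod d1 subU1.
have ndU2 := perp_nondegenerate subU1 dU1 Qd1 nz2 ndU1.
have := card_perp subU1 dU1 Qd1 nz2; rewrite -cardU1 => /eqP.
rewrite eqn_pmul2l // => /eqP cardU2.
set W := perp _ d1 in subU2 ndU2 cardU2.
pose Z x := #|[set u in W | Q u == x]|.
have split_count x : #|[set u in U | Q u == x]| =
    (\sum_s \sum_t Z (x - (Q d * s ^+ 2 + Q d1 * t ^+ 2))%R)%N.
  rewrite (card_linear_fibres (fun u => Q u == x) subU dU Qd nz2).
  apply: eq_bigr => s _.
  rewrite (card_linear_fibres (fun u => Q (s *: d + u) == x) subU1 dU1 Qd1 nz2).
  apply: eq_bigr => t _; apply: eq_card => u; rewrite !inE.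
  have [uU|] //= := boolP (u \in U); have [ud|] //= := eqVneq (polar Q u d) 0.
  have [ud1|] //= := eqVneq (polar Q u d1) 0.
  move: dU1; rewrite inE => /andP [_ /eqP d1d].
  rewrite !(quadraticDZ quadQ) (polarC _ d) (polarDZl quadQ) ud d1d.
  rewrite (polarC _ d1 u) ud1 -subr_eq0 -[RHS]subr_eq0.
  by congr (_ == 0); ring.
rewrite !split_count.
rewrite (sum_binary_form_scale (fun x => Z (N * c - x)) nz2 Qd Qd1 N0).
by apply: eq_bigr => s _; apply: eq_bigr => t _; rewrite -mulrBr; apply: IH.
Qed.


Lemma level_card_sqr_scale a c : a != 0 ->
  #|[set u | Q u == a ^+ 2 * c]| = #|[set u | Q u == c]|.
Proof.
move=> a0; rewrite !card_setE (reindex_inj (scalerI a0)); apply: eq_bigr => u _.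
by rewrite (quadraticZ quadQ) (inj_eq (mulfI (expf_neq0 2 a0))).
Qed.

Lemma level_card_scale (n : nat) N c :
  nondegenerate_on Q [set: V] -> #|V| = (#|F| ^ (2 * n))%N -> N != 0 ->
  #|[set u | Q u == N * c]| = #|[set u | Q u == c]|.
Proof.
move=> ndV cardV N0; have [z2|nz2] := eqVneq (2%:R : F) 0; last first.
  have E b : [set u | Q u == b] = [set u in [set: V] | Q u == b].
    by apply/setP => u; rewrite !inE.
  rewrite !E (level_card_scale_odd (n := n)) ?cardsT //.
  by split=> [|? ? ? _ _]; rewrite inE.
(* In characteristic 2 squaring is injective, hence bijective on the finite field, so [N] is a
   square. *)
have sqr_inj : injective (fun x : F => x ^+ 2).
  move=> x y /eqP; rewrite eqf_sqr => /orP [/eqP //|/eqP ->].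
  by apply/eqP; rewrite eq_sym -subr_eq0 opprK -mulr2n -mulr_natl z2 mul0r.
have [sqrt _ sqrtK] := injF_bij sqr_inj.
rewrite -(sqrtK N) level_card_sqr_scale //; apply: contraNneq N0 => s0.
by rewrite -(sqrtK N) s0 expr0n.
Qed.

Definition radical U := [set v in U | [forall u in U, polar Q u v == 0]].

Lemma radicalP U v :
  reflect (v \in U /\ {in U, forall u, polar Q u v = 0}) (v \in radical U).
Proof.
rewrite inE; apply: (iffP andP) => -[vU]; split=> //; last first.
  by apply/forall_inP => u uU; apply/eqP/b.
by move=> u uU; apply/eqP; move/forall_inP: b; apply.
Qed.

(* In characteristic 2 the polar form is alternating, so U splits off
   hyperbolic planes until only its radical is left. *)
Lemma card_radical_char2 U :
  (2%:R : F) = 0 -> submod_closed U ->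
  exists k, #|U| = (#|F| ^ (2 * k) * #|radical U|)%N.
Proof.
move=> z2; have [n] := ubnP #|U|; elim: n U => // n IH U leUn subU.
have alt v : polar Q v v = 0 by rewrite (polarvv quadQ) z2 mul0r.
have [U0 UL] := subU.
have [/exists_inP [a aU /exists_inP [b bU ab]]|/exists_inPn h] :=
  boolP [exists a in U, exists b in U, polar Q a b != 0]; last first.
  exists 0%N; rewrite muln0 expn0 mul1n; apply: eq_card => v.
  apply/idP/radicalP => [vU|[] //]; split=> // u uU.
  by have /exists_inPn /(_ v vU) := h u uU; rewrite negbK => /eqP.
set W := perp (perp U a) b.
have cardU : #|U| = (#|F| ^ 2 * #|W|)%N.
  rewrite -[#|U|]sum1_card.
  (* Coordinates of [u] on [a] and [b]: the form being alternating, pairing with [b] isolates the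
     coefficient of [a], and conversely. *)
  rewrite (partition_big (fun u => (polar Q u b / polar Q a b,
    polar Q u a / polar Q a b)) predT) //= -mulnn -card_prod -sum_nat_const.
  apply: eq_bigr => -[s t] _.
  rewrite (reindex_inj (addrI (s *: a + t *: b))) -sum1_card.
  apply: eq_bigl => u; rewrite !inE xpair_eqE !(polarDl quadQ) !(polarZl quadQ).
  rewrite !alt (polarC _ b a) !mulr0 addr0 add0r.
  move: (polar Q u b) (polar Q u a) => y x; rewrite !mulrDl !mulfK //.
  have addl_eq (r r' : F) : (r + r' == r) = (r' == 0).
    by rewrite -subr_eq0 addrAC addrN add0r.
  rewrite !addl_eq !mulf_eq0 !invr_eq0 (negPf ab) !orbF.
  rewrite (andbC (y == 0)) andbA.
  congr (_ && _ && _); have V0 : s *: a + t *: b \in U.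
    by rewrite UL // -[t *: b]addr0 UL.
  apply/idP/idP => h; last by rewrite -[s *: a + _]scale1r UL.
  by rewrite -(addKr (s *: a + t *: b) u) -scaleN1r UL.
have radE : radical W = radical U.
  apply/setP => v; apply/radicalP/radicalP => -[vW h]; last first.
    split=> [|u]; last by rewrite !inE => /andP [/andP [/h]].
    by rewrite !inE vW (polarC _ v a) (polarC _ v b) !h ?eqxx.
  move: (vW); rewrite !inE => /andP [/andP [vU /eqP va] /eqP vb].
  (* [w] is the component of [u] in [W]; the part removed lies in the plane of [a] and [b], which is
     orthogonal to [v]. *)
  split=> // u uU; pose s := polar Q u b / polar Q a b.
  pose t := polar Q u a / polar Q a b; pose w := (- s) *: a + ((- t) *: b + u).
  have := h w; rewrite /w !inE !UL //.
  rewrite !(polarDl quadQ) !(polarZl quadQ) !alt (polarC _ b a) !mulNr !divfK //.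
  rewrite (polarC _ a v) (polarC _ b v) va vb !mulr0 !oppr0 !add0r !addNr eqxx.
  by apply.
have q_gt1 := finNzRing_gt1 F; have subW := perp_submod b (perp_submod a subU).
have W_gt0 : (0 < #|W|)%N by apply/card_gt0P; exists 0; case: subW.
have [|k cardW] := IH W _ subW.
  rewrite -ltnS (leq_trans _ leUn) // ltnS cardU -[ltnLHS]mul1n.
  by rewrite ltn_pmul2r // -(exp1n 2) ltn_exp2r.
by exists k.+1; rewrite cardU cardW radE mulnA -expnD mulnS.
Qed.

(** In odd characteristic a radical vector has [2 Q v = 0]. In characteristic 2 the radical has even
    dimension, and [Q] is injective on it because two radical vectors of equal value differ by a
    radical zero of [Q]; having at most [#|F|] elements, it is trivial. *)
Lemma nondegenerate_even (m : nat) :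
  #|V| = (#|F| ^ (2 * m))%N ->
  (forall v, (forall u, polar Q u v = 0) -> Q v = 0 -> v = 0) ->
  nondegenerate_on Q [set: V].
Proof.
move=> cardV h v _ polv0; have {}polv0 u : polar Q u v = 0.
  by apply: polv0; rewrite inE.
apply: (h _ polv0).
have [z2|nz2] := eqVneq (2%:R : F) 0; last first.
  by apply/eqP; rewrite -(mulrI_eq0 _ (mulfI nz2)) -(polarvv quadQ) polv0.
have subV : submod_closed [set: V] by split=> [|? ? ? _ _]; rewrite inE.
have q_gt1 := finNzRing_gt1 F.
have q_gt0 : (0 < #|F|)%N by apply: ltnW.
have [k] := card_radical_char2 z2 subV; rewrite cardsT cardV => cardR.
have [v0|nzv] := eqVneq v 0; first by rewrite v0 (quadratic0 quadQ).
set R := radical _ in cardR.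
have vR : v \in R by apply/radicalP; rewrite inE; split.
have R0 : 0 \in R.
  by apply/radicalP; rewrite inE; split=> // u _; apply: polar0r.
have R_gt1 : (1 < #|R|)%N by apply/card_gt1P; exists v, 0.
have ltkm : (k < m)%N.
  rewrite ltnNge; apply/negP => lemk; move: cardR.
  apply/eqP; rewrite ltn_eqF // -[ltnLHS]muln1.
  rewrite (leq_ltn_trans (_ : _ <= #|F| ^ (2 * k) * 1)%N) //.
    by rewrite leq_mul2r leq_exp2l // leq_mul2l lemk orbT.
  by rewrite ltn_pmul2l // expn_gt0 q_gt0.
(* The order of [R] is [#|F|] to the positive even power [2 * (m - k)]. *)
have RF : (#|F| < #|R|)%N.
  rewrite -(@ltn_pmul2l (#|F| ^ (2 * k))) ?expn_gt0 ?q_gt0 // -cardR -expnSr.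
  by rewrite ltn_exp2l //; lia.
have /dinjectivePn [x xR [y /andP [/= nyx yR] Qxy]] : ~~ dinjectiveb Q R.
  apply/negP => /dinjectiveP Qinj; move: RF.
  by rewrite -(card_in_imset Qinj) ltnNge max_card.
move/radicalP: xR => [_ xR]; move/radicalP: yR => [_ yR].
have polz u : polar Q u (x - y) = 0.
  by rewrite -scaleN1r (polarDr quadQ) (polarZr quadQ) xR ?yR ?inE // mulr0 addr0.
case/eqP: nyx; apply/esym/eqP; rewrite -subr_eq0; apply/eqP/h => //.
rewrite (quadraticD Q x) (quadraticN quadQ) -scaleN1r (polarZr quadQ).
by rewrite yR ?inE // mulr0 addr0 Qxy -mulr2n -mulr_natl z2 mul0r.
Qed.

Hypothesis ndV : nondegenerate_on Q [set: V].

Lemma exists_polar_eq1 d : d != 0 -> exists e, polar Q e d = 1.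
Proof.
move=> d0; have [/existsP [e ed]|/existsPn h] :=
    boolP [exists e, polar Q e d != 0].
  by exists ((polar Q e d)^-1 *: e); rewrite (polarZl quadQ) mulVf.
case/eqP: d0; apply: ndV; first by rewrite inE.
by move=> u _; apply/eqP; have := h u; rewrite negbK.
Qed.

(** Translations by multiples of [e], where [polar Q e d = 1], carry any level onto any other, so
    all levels have the same size. *)
Lemma card_polar_level d c : d != 0 ->
  (#|F| * #|[set u | polar Q u d == c]|)%N = #|V|.
Proof.
move=> d0; have [e ed] := exists_polar_eq1 d0.
rewrite -[#|V|]sum1_card (partition_big (fun u => polar Q u d) predT) //=.
rewrite -sum_nat_const; apply: eq_bigr => b _.
rewrite sum1dep_card !card_setE (reindex_inj (addrI ((c - b) *: e))).
apply: eq_bigr => u _; congr (nat_of_bool _).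
rewrite (polarDl quadQ) (polarZl quadQ) ed mulr1 -subr_eq0 -[RHS]subr_eq0.
by congr (_ == 0); ring.
Qed.

(* For each slope w the count below runs over a line through (a, s); every point
   (Q u, B(u, d)) other than (a, s) lies on one such line unless B(u, d) = s. *)
Lemma sum_pencil_level d a s :
  (\sum_(w : F) #|[set u | Q u == (a + w * s + w ^+ 2 * Q d)%R]| +
    #|[set u | polar Q u d == s]| =
   #|F| * #|[set u | (Q u == a) && (polar Q u d == s)]| + #|V|)%N.
Proof.
have E w : #|[set u | Q u == a + w * s + w ^+ 2 * Q d]| =
    (\sum_u (Q u - a + w * (polar Q u d - s) == 0)%R)%N.
  (* Translating by [w *: d] cancels the terms in [w ^+ 2] and leaves an equation linear in [w]. *)
  rewrite card_setE (reindex_inj (addrI (w *: d))); apply: eq_bigr => u _.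
  rewrite (quadraticDZ quadQ) (polarC _ d u) -subr_eq0; congr (nat_of_bool (_ == 0)).
  by ring.
rewrite (eq_bigr _ (fun w _ => E w)) exchange_big /= !card_setE.
rewrite -[#|V|]sum1_card big_distrr /= -!big_split /=; apply: eq_bigr => u _.
rewrite -[polar Q u d == s]subr_eq0 -[Q u == a]subr_eq0.
move: (_ - a) (_ - s) => x y; have [->|y0] := eqVneq y 0.
  rewrite andbT (eq_bigr (fun=> (x == 0 : nat))) ?sum_nat_const //.
  by move=> w _; rewrite mulr0 addr0.
rewrite andbF muln0 addn0 (bigD1 (- x / y)) //= mulfVK // addrN eqxx.
rewrite big1 // => w nw; apply/eqP; rewrite eqb0; apply: contraNneq nw => h.
by apply/eqP/(mulIf y0); rewrite divfK //; apply/eqP; rewrite -subr_eq0 opprK addrC h.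
Qed.

Lemma card_level_polar d a s : d != 0 ->
  (#|F| ^ 2 * #|[set u | (Q u == a)%R && (polar Q u d == s)]| + #|F| * #|V| =
   #|F| * \sum_(w : F) #|[set u | Q u == (a + w * s + w ^+ 2 * Q d)%R]| + #|V|)%N.
Proof.
move=> d0; rewrite -[in RHS](card_polar_level s d0) -mulnDr sum_pencil_level.
by rewrite mulnDr mulnA mulnn.
Qed.

End Counting.

(** * Common neighbours in terms of root counts *)

Section CommonNeighbours.

Variables (F : finFieldType) (E : {set F}).
Hypothesis E0 : 0 \notin E.

(* The number of (a, b, w) with a, b in E such that w is a root of
   a + (b - a - x) w + x w^2. *)
Definition root_count (x : F) : nat :=
  (\sum_(p in setX E E)
     #|[set w : F | (p.1 + w * (p.2 - p.1 - x) + w ^+ 2 * x == 0)%R]|)%N.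

(** At [x = 0] the equation is [a + w * (b - a) = 0]: one root if [a != b], none if [a = b], since
    [a] is nonzero. *)
Lemma root_count0 : (root_count 0%R + #|E| = #|E| ^ 2)%N.
Proof.
rewrite -mulnn -cardsX -[#|setX E E|]sum1_card /root_count.
have -> : #|E| = (\sum_(p in setX E E) (p.1 == p.2))%N.
  rewrite -sum1_card big_mkcond /=.
  rewrite [RHS](eq_bigl (fun p => (p.1 \in E) && (p.2 \in E))); last first.
    by move=> [a b]; rewrite inE.
  rewrite -(pair_big (mem E) (mem E) (fun a b : F => (a == b : nat))) /=.
  rewrite -big_mkcond /=; apply: eq_bigr => a aE.
  rewrite (bigD1 a) //= eqxx big1 ?addn0 // => b /andP [_ /negPf nba].
  by rewrite eq_sym nba.
rewrite -big_split /=; apply: eq_bigr => -[a b]; rewrite inE /= => /andP [aE bE].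
have a0 : a != 0 by apply: contraNneq E0 => <-.
have [<-|nab] := eqVneq a b.
  rewrite (_ : [set w | _] = set0) ?cards0 //; apply/setP => w.
  by rewrite !inE subr0 subrr !mulr0 !addr0 (negPf a0).
have ba0 : b - a != 0 by rewrite subr_eq0 eq_sym.
rewrite addn0 (_ : [set w | _] = [set (- a / (b - a))]) ?cards1 //.
apply/setP => w; rewrite !inE subr0 mulr0 addr0.
rewrite -[RHS](inj_eq (mulIf ba0)) divfK // -[RHS]subr_eq0.
by congr (_ == 0); ring.
Qed.

Variables (V : finLmodType F) (Q : V -> F).
Hypotheses (quadQ : quadratic_map Q) (ndQ : nondegenerate_on Q [set: V]).
Variables (m : nat) (cardV : #|V| = (#|F| ^ (2 * m))%N).
Implicit Types (u v d : V) (c : F).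

Lemma level_card_const c : c != 0 ->
  #|[set u | Q u == c]| = #|[set u | Q u == 1]|.
Proof. by move=> c0; rewrite -[c]mulr1 (level_card_scale quadQ _ ndQ cardV). Qed.

Lemma card_levels :
  #|V| = (#|[set u | Q u == 0%R]| + (#|F| - 1) * #|[set u | Q u == 1%R]|)%N.
Proof.
rewrite -[#|V|]sum1_card (partition_big Q predT) //= (bigD1 0) //= sum1dep_card.
congr (_ + _)%N.
rewrite (eq_bigr (fun=> #|[set u | Q u == 1%R]|)) => [|c c0].
  rewrite sum_nat_const subn1; congr (_ * _)%N; exact: cardC1.
by rewrite sum1dep_card level_card_const.
Qed.

Definition common_count d := #|[set u | (Q u \in E) && (Q (u + d) \in E)]|.

Lemma common_count_partition d :
  common_count d = (\sum_(p in setX E E)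
    #|[set u | (Q u == p.1) && (polar Q u d == p.2 - p.1 - Q d)%R]|)%N.
Proof.
rewrite /common_count -sum1dep_card.
rewrite (partition_big (fun u => (Q u, Q (u + d))) (mem (setX E E))) /=; last first.
  by move=> u; rewrite inE.
apply: eq_bigr => -[a b]; rewrite inE /= => /andP [aE bE].
rewrite sum1dep_card; apply: eq_card => u; rewrite !inE xpair_eqE.
apply/andP/andP => -[].
  by move=> _ /andP [/eqP <- /eqP <-]; rewrite eqxx /polar addrAC.
move=> /eqP ua /eqP h; have -> : Q (u + d) = b.
  by rewrite (quadraticD Q) h ua; ring.
by rewrite ua !eqxx aE bE.
Qed.

(** A zero of [f] contributes the zero level, any other slope a level of the common nonzero size;
    terms are transposed to avoid truncated subtraction. *)
Lemma sum_level_pencil (f : F -> F) :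
  (\sum_w #|[set u | Q u == f w]| +
     #|[set w | f w == 0%R]| * #|[set u | Q u == 1%R]| =
   #|[set w | f w == 0%R]| * #|[set u | Q u == 0%R]| +
     #|F| * #|[set u | Q u == 1%R]|)%N.
Proof.
rewrite card_setE -[in #|F|]sum1_card !big_distrl -!big_split /=.
apply: eq_bigr => w _; have [->|fw0] := eqVneq (f w) 0; first by rewrite !mul1n.
by rewrite level_card_const // !mul0n addn0 mul1n.
Qed.

Lemma common_count_root_count d : d != 0 ->
  (#|F| ^ 2 * common_count d + #|F| * #|V| * #|E| ^ 2 +
     #|F| * (root_count (Q d) * #|[set u | Q u == 1%R]|) =
   #|F| * (root_count (Q d) * #|[set u | Q u == 0%R]| +
     #|F| * #|[set u | Q u == 1%R]| * #|E| ^ 2) + #|V| * #|E| ^ 2)%N.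
Proof.
move=> d0; rewrite common_count_partition /root_count.
rewrite -[(#|E| ^ 2)%N]mulnn -cardsX -[#|setX E E|]sum1_card.
rewrite !(big_distrl, big_distrr) -!big_split /= !(big_distrl, big_distrr) /=.
rewrite -!big_split /=; apply: eq_bigr => -[a b] _ /=.
rewrite !muln1 (card_level_polar quadQ ndQ) // -sum_level_pencil mulnDr.
by rewrite addnAC.
Qed.

Lemma common_count_eq d d' : d != 0 -> d' != 0 ->
  root_count (Q d) = root_count (Q d') -> common_count d = common_count d'.
Proof.
move=> d0 d0' eqR; have := common_count_root_count d0.
rewrite eqR -(common_count_root_count d0') => /addIn /addIn /eqP.
have q_gt0 := ltnW (finNzRing_gt1 F).
by rewrite eqn_pmul2l ?expn_gt0 ?q_gt0 // => /eqP.
Qed.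

(** All nonzero levels have one size; were it 0, [Q] would vanish identically, against
    [exists_anisotropic]. *)
Lemma level_gt0 c : (0 < m)%N -> c != 0 -> exists u, Q u = c.
Proof.
move=> m0 c0; have [/existsP [u /eqP]|/existsPn h] := boolP [exists u, Q u == c].
  by exists u.
have cE : #|[set u | Q u == c]| = 0%N.
  apply/eqP; rewrite cards_eq0 -subset0; apply/subsetP => u.
  by rewrite inE (negPf (h u)).
have Q0 u : Q u = 0.
  apply/eqP; apply/negPn/negP => u0; have := cE.
  rewrite level_card_const // -(level_card_const u0) => /eqP.
  by rewrite cards_eq0 => /eqP /setP /(_ u); rewrite !inE eqxx.
have V_gt1 : (1 < #|[set: V]|)%N.
  by rewrite cardsT cardV -(expn0 #|F|) ltn_exp2l ?finNzRing_gt1 // muln_gt0.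
have subV : submod_closed [set: V] by split=> [|? ? ? _ _]; rewrite inE.
by have [d _] := exists_anisotropic ndQ subV V_gt1; rewrite Q0 eqxx.
Qed.

End CommonNeighbours.

(** * Cayley graphs defined by the values of a quadratic map *)

Section Cayley.

Variables (F : finFieldType) (E : {set F}).
Variables (V : finLmodType F) (Q : V -> F) (D : {set V}).
Hypotheses (quadQ : quadratic_map Q) (defD : forall u, (u \in D) = (Q u \in E)).

Lemma card_cayley_neighbours x :
  #|[set y | cayley D x y]| = #|[set u | Q u \in E]|.
Proof.
rewrite !card_setE (reindex_inj (addrI x)); apply: eq_bigr => u _.
by rewrite /cayley defD opprD addNKr (quadraticN quadQ).
Qed.

Lemma card_cayley_common x y :
  #|[set z | cayley D x z && cayley D y z]| = common_count E Q (x - y).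
Proof.
rewrite /common_count !card_setE (reindex_inj (subrI y)); apply: eq_bigr => u _.
by rewrite /cayley !defD subKr opprB addrCA andbC.
Qed.

Lemma cayley_symmetric : symmetric (cayley D).
Proof. by move=> x y; rewrite /cayley !defD -opprB (quadraticN quadQ). Qed.

Lemma cayley_irreflexive : 0 \notin E -> irreflexive (cayley D).
Proof. by move=> E0 x; rewrite /cayley defD subrr (quadratic0 quadQ) (negPf E0). Qed.

(** The value [j] is required at [c = 0] too, because distinct nonadjacent vertices may differ by a
    nonzero zero of [Q]. *)
Lemma strongly_regular_of_root_count (m i j : nat) :
  0 \notin E -> (exists c, c \in E) -> (exists2 c, c != 0 & c \notin E) ->
  nondegenerate_on Q [set: V] -> #|V| = (#|F| ^ (2 * m))%N -> (0 < m)%N ->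
  {in E, forall c, root_count E c = i} ->
  (forall c, c \notin E -> root_count E c = j) ->
  strongly_regular (cayley D).
Proof.
move=> E0 [c cE] [c' c'0 c'E] ndQ cardV m_gt0 rc_in rc_out.
have c0 : c != 0 by apply: contraNneq E0 => <-.
have nzQ u : Q u != 0 -> u != 0.
  by apply: contraNneq => ->; rewrite (quadratic0 quadQ).
have [d Qd] := level_gt0 quadQ ndQ cardV m_gt0 c0.
have [d' Qd'] := level_gt0 quadQ ndQ cardV m_gt0 c'0.
have d0 : d != 0 by rewrite nzQ // Qd.
have d'0 : d' != 0 by rewrite nzQ // Qd'.
exists #|V|, #|[set u | Q u \in E]|, (common_count E Q d), (common_count E Q d').
split=> //.
- exact: cayley_symmetric.
- exact: cayley_irreflexive.
- by exists d, 0; rewrite /cayley defD subr0 Qd.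
- by exists d', 0; rewrite /cayley defD subr0 Qd'.
- exact: card_cayley_neighbours.
- move=> x y; rewrite /cayley defD => xyE; rewrite card_cayley_common.
  apply: (common_count_eq quadQ ndQ cardV) => //.
    by apply: nzQ; apply: contraNneq E0 => <-.
  by rewrite !rc_in // Qd.
- move=> x y nxy; rewrite /cayley defD => xyE; rewrite card_cayley_common.
  apply: (common_count_eq quadQ ndQ cardV) => //; first by rewrite subr_eq0.
  by rewrite !rc_out // Qd'.
Qed.

End Cayley.

(** * Nonsingular forms in coordinates and their radical *)

Lemma quadratic_form_map (F : fieldType) (n : nat) (Q : 'rV[F]_n -> F) :
  quadratic_form Q -> quadratic_map Q.
Proof. by case=> QZ Qs _. Qed.

(** If [v] were nonzero, then in a basis whose last vector is proportional to [v] the form would not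
    depend on the last coordinate. *)
Lemma nonsingular_radical (F : fieldType) (n : nat) (Q : 'rV[F]_n -> F) v :
  (0 < n)%N -> quadratic_form Q -> nonsingular Q ->
  (forall u, polar Q u v = 0) -> Q v = 0 -> v = 0.
Proof.
case: n Q v => // n Q v _ formQ nsQ polv Qv.
have quadQ := quadratic_form_map formQ.
apply/eqP/negPn/negP => nzv; apply: nsQ.
(* The first row of [row_ebase v] is proportional to [v]; the transposition makes it the last. *)
pose A := row_perm (tperm ord0 ord_max) (row_ebase v).
have Aunit : A \in unitmx.
  by rewrite /A row_permE unitmx_mul unitmx_perm row_ebase_unit.
have [c c0 vE] : exists2 c, c != 0 & v = c *: row ord_max A.
  pose r := col_ebase v *m pid_mx (\rank v) : 'rV[F]_n.+1.
  have rE : r = r 0 0 *: delta_mx 0 0.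
    apply/rowP => j; rewrite /r !mxE !big_ord1 !mxE eqxx rank_rV nzv !andbT.
    by rewrite (eq_sym j) mulr1.
  have vr : v = r 0 0 *: row ord_max A.
    rewrite -[LHS](mulmx_ebase v) -/r rE -scalemxAl !mxE eqxx mulr1 -rowE.
    by congr (_ *: _); apply/rowP => j; rewrite !mxE tpermR.
  by exists (r 0 0) => //; apply: contraNneq nzv => c0; rewrite vr c0 scale0r.
set w := row ord_max A in vE.
have polw u : polar Q u w = 0.
  by apply: (mulfI c0); rewrite -(polarZr quadQ) -vE polv mulr0.
have Qw : Q w = 0.
  by apply: (mulfI (expf_neq0 2 c0)); rewrite -(quadraticZ quadQ) -vE Qv mulr0.
pose B : 'M[F]_(n, n.+1) := rowsub (widen_ord (leqnSn n)) A.
exists n, (ltnSn n), A, (fun y => Q (y *m B)); split=> //.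
  case: formQ => QZ Qr Ql; split=> [a y|y a y1 y2|y a y1 y2].
  - by rewrite -scalemxAl QZ.
  - by rewrite /polar_form !mulmxDl -scalemxAl; apply: Qr.
  - by rewrite /polar_form !mulmxDl -scalemxAl; apply: Ql.
move=> x; have -> : x *m A = x 0 ord_max *: w +
    colsub (widen_ord (ltnW (ltnSn n))) x *m B.
  rewrite !mulmx_sum_row big_ord_recr addrC; congr (_ + _).
  apply: eq_bigr => i _; rewrite !mxE.
  have -> : widen_ord (leqnSn n) i = widen_ord (ltnW (ltnSn n)) i.
    exact: val_inj.
  by congr (_ *: _); apply/rowP => j; rewrite !mxE; congr (row_ebase v _ j);
    congr (tperm _ _ _); apply: val_inj.
by rewrite (quadraticDZ quadQ) Qw (polarC _ w) polw !mulr0 add0r addr0.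
Qed.

(** * Cyclotomic classes in terms of exponents *)

Lemma mem_cyclotomic_class (K : finFieldType) (g : K) (n e i k : nat) :
  n.-primitive_root g -> (n < #|K|)%N -> (e %| n)%N ->
  (g ^+ k \in cyclotomic_class g e i) = (k == i %[mod e]).
Proof.
move=> gP ltnK en; have n_gt0 := prim_order_gt0 gP; apply/imsetP/eqP => [[j _]|].
  rewrite -exprM -exprD => /eqP; rewrite (eq_prim_root_expr gP) => /eqP h.
  by rewrite -(modn_dvdm k en) h modn_dvdm // mulnC addnC modnMDl.
(* Adding [n * i] does not change the power of [g] and keeps the subtraction of [i] from
   truncating. *)
move=> ki; have le_i : (i <= k + n * i)%N.
  by rewrite (leq_trans _ (leq_addl _ _)) // leq_pmull.
have /dvdnP [l lE] : (e %| k + n * i - i)%N.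
  rewrite -eqn_mod_dvd //; have [n' ->] := dvdnP en.
  by rewrite mulnAC addnC modnMDl ki.
have ltl : (l %% n < #|K|)%N by rewrite (ltn_trans _ ltnK) // ltn_mod.
exists (Ordinal ltl) => //=.
rewrite expr_mod; last by rewrite exprAC (prim_expr_order gP) expr1n.
rewrite -exprM -exprD mulnC -lE subnKC // exprD exprM.
by rewrite (prim_expr_order gP) expr1n mulr1.
Qed.

(* An alias of K, so that its F-module structure can depend on iota. *)
Definition restriction (F K : finFieldType) (iota : {rmorphism F -> K}) : Type := K.

(** * The norm from [K] to [F] as a quadratic map *)

Section Restriction.

Variables (F K : finFieldType) (iota : {rmorphism F -> K}).
Local Notation L := (restriction iota).

HB.instance Definition _ := FinRing.Zmodule.on L.

Definition restriction_scale (a : F) (x : L) : L := iota a * (x : K).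

Fact restriction_scaleA a b x :
  restriction_scale a (restriction_scale b x) = restriction_scale (a * b) x.
Proof. by rewrite /restriction_scale rmorphM mulrA. Qed.

Fact restriction_scale1 : left_id 1 restriction_scale.
Proof. by move=> x; rewrite /restriction_scale rmorph1 mul1r. Qed.

Fact restriction_scaleDr : right_distributive restriction_scale +%R.
Proof. by move=> a x y; rewrite /restriction_scale mulrDr. Qed.

Fact restriction_scaleDl x : {morph restriction_scale^~ x : a b / a + b}.
Proof. by move=> a b; rewrite /restriction_scale rmorphD mulrDl. Qed.

HB.instance Definition _ := GRing.Zmodule_isLmodule.Build F L
  restriction_scaleA restriction_scale1 restriction_scaleDr restriction_scaleDl.

Variable N : L -> F.
Hypothesis normE : forall x, iota (N x) = (x : K) ^+ (#|F| + 1).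

(** The map [x ^+ #|F|] is additive and fixes the image of [iota], so the polar form is
    [u ^+ #|F| * v + u * v ^+ #|F|], linear over [F]. *)
Lemma norm_quadratic : quadratic_map N.
Proof.
have Fr (a : F) : iota a ^+ #|F| = iota a by rewrite -rmorphXn /= expf_card.
have charK : [pchar K].-nat #|F|.
  have := card_finField_pnat (erefl #|F|); apply: sub_in_pnat => p _.
  by rewrite (fmorph_pchar iota).
have FrD (x y : K) : (x + y) ^+ #|F| = x ^+ #|F| + y ^+ #|F|.
  exact: exprDn_pchar.
have polarE (u v : L) : iota (polar N u v) =
    (u : K) ^+ #|F| * (v : K) + (u : K) * (v : K) ^+ #|F|.
  rewrite /polar !rmorphB /= !normE !addn1 !exprSr FrD; ring.
split=> [a v|u a v w]; apply: (fmorph_inj iota).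
  rewrite rmorphM rmorphXn /= !normE (_ : (a *: v : L) = iota a * (v : K) :> K) //.
  by rewrite addn1 !exprSr exprMn Fr expr0; ring.
rewrite [RHS]rmorphD [X in _ = X + _]rmorphM !polarE.
rewrite (_ : (a *: v + w : L) = (iota a * (v : K) + (w : K)) :> K) //.
by rewrite FrD exprMn Fr; ring.
Qed.

Lemma norm_eq0 x : N x = 0 -> x = 0.
Proof.
move=> Nx; have /eqP := normE x.
by rewrite Nx rmorph0 eq_sym expf_eq0 => /andP [_ /eqP].
Qed.

Hypothesis cardK : #|K| = (#|F| ^ 2)%N.

Lemma norm_nondegenerate : nondegenerate_on N [set: L].
Proof.
by apply: (nondegenerate_even norm_quadratic (m := 1)) => // v _; apply: norm_eq0.
Qed.

Lemma norm_level0 : #|[set u | N u == 0]| = 1%N.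
Proof.
rewrite -(cards1 (0 : L)); apply: eq_card => u; rewrite !inE.
apply/eqP/eqP => [/norm_eq0 //|->]; exact: (quadratic0 norm_quadratic).
Qed.

(** With [q = #|F|], the [q ^ 2 - 1] nonzero elements are shared equally by [q - 1] levels. *)
Lemma norm_level1 : #|[set u | N u == 1]| = (#|F| + 1)%N.
Proof.
have := card_levels norm_quadratic norm_nondegenerate (m := 1) cardK.
rewrite norm_level0 [LHS]cardK => h; have := finNzRing_gt1 F.
move: #|[set u | N u == 1]| #|F| h => z q h q_gt1.
have h1 : (q ^ 2 - 1 = (q - 1) * z)%N by rewrite h addKn.
rewrite -[1%N in LHS](exp1n 2) subn_sqr in h1.
by apply/esym/eqP; rewrite -(@eqn_pmul2l (q - 1)) ?subn_gt0 // h1.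
Qed.

(** The general affine relation, simplified by the level sizes 1 and [#|F| + 1] of the norm. *)
Lemma norm_common_count (E : {set F}) d : d != 0 ->
  (common_count E N d + root_count E (N d) = 2 * #|E| ^ 2)%N.
Proof.
move=> d0.
have := common_count_root_count E norm_quadratic norm_nondegenerate (m := 1) cardK d0.
rewrite norm_level0 norm_level1 [#|{: L}|]cardK; have := ltnW (finNzRing_gt1 F).
move: (common_count _ _ _) (root_count _ _) (#|E|) (#|F|) => n r k q q0 h.
by apply/eqP; rewrite -(@eqn_pmul2l (q ^ 2)) ?expn_gt0 ?q0 //; apply/eqP; nia.
Qed.

Lemma norm_level_card (E : {set F}) :
  0 \notin E -> #|[set u | N u \in E]| = (#|E| * (#|F| + 1))%N.
Proof.
move=> E0; rewrite -sum1dep_card (partition_big N (mem E)) //=.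
rewrite -sum_nat_const; apply: eq_bigr => c cE.
have c0 : c != 0 by apply: contraNneq E0 => <-.
rewrite -norm_level1.
rewrite -(level_card_const norm_quadratic norm_nondegenerate (m := 1) cardK c0).
rewrite sum1dep_card; apply: eq_card => u; rewrite !inE.
by case: eqP => [->|]; rewrite ?cE ?andbF.
Qed.

End Restriction.

(** * Transfer from the norm graph to every nonsingular form *)

Theorem theorem4p3 (q : nat) (F K : finFieldType) (iota : {rmorphism F -> K})
    (cardF : #|F| = q) (cardK : #|K| = (q ^ 2)%N)
    (e : nat) (e_gt1 : (1 < e)%N) (e_dvd : (e %| q - 1)%N)
    (I : {set 'I_e})
    (gamma : K) (gamma_prim : (q ^ 2 - 1).-primitive_root gamma)
    (omega : F) (omega_norm : iota omega = gamma ^+ (q + 1))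
    (E : {set F}) (defE : E = \bigcup_(i in I) cyclotomic_class omega e i)
    (nlst : negative_latin_square_type
              (cayley (\bigcup_(i in I) cyclotomic_class gamma e i))) :
  forall (m : nat) (Q : 'rV[F]_(2 * m) -> F),
    (0 < m)%N -> quadratic_form Q -> nonsingular Q ->
    strongly_regular (cayley [set x : 'rV[F]_(2 * m) | Q x \in E]).
Proof.
have q_gt1 : (1 < q)%N by rewrite -cardF finNzRing_gt1.
have q_gt0 := ltnW q_gt1.
have q2E : (q ^ 2 - 1 = (q - 1) * (q + 1))%N by rewrite -[1%N in LHS](exp1n 2) subn_sqr.
have e_dvd2 : (e %| q ^ 2 - 1)%N by rewrite q2E dvdn_mulr.
have omega_prim : (q - 1).-primitive_root omega.
  rewrite -(fmorph_primitive_root iota) omega_norm.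
  have := dvdn_prim_root gamma_prim (m := q - 1).
  by rewrite q2E dvdn_mulr // mulKn ?subn_gt0 //; apply.
(* As [e] divides both [q - 1] and [q ^ 2 - 1], membership in [E] and in [D] is the same condition
   on exponents modulo [e]. *)
have memE k : (omega ^+ k \in E) = [exists i in I, k == i %[mod e]].
  rewrite defE; apply/bigcupP/exists_inP => -[i iI ki]; exists i => //.
    by rewrite -(mem_cyclotomic_class i k omega_prim) // cardF subn1 prednK.
  by rewrite (mem_cyclotomic_class i k omega_prim) // cardF subn1 prednK.
set D := \bigcup_(i in I) cyclotomic_class gamma e i in nlst.
have memD k : (gamma ^+ k \in D) = [exists i in I, k == i %[mod e]].
  have ltK : (q ^ 2 - 1 < #|K|)%N by rewrite cardK subn1 prednK // expn_gt0 q_gt0.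
  apply/bigcupP/exists_inP => -[i iI ki]; exists i => //.
    by rewrite -(mem_cyclotomic_class i k gamma_prim).
  by rewrite (mem_cyclotomic_class i k gamma_prim).
have g0 : gamma != 0.
  apply: contra_eq_neq (prim_expr_order gamma_prim) => ->.
  by rewrite expr0n gtn_eqF ?(prim_order_gt0 gamma_prim) // eq_sym oner_eq0.
have w0 : omega != 0 by rewrite -(fmorph_eq0 iota) omega_norm expf_neq0.
have E0 : 0 \notin E.
  rewrite defE; apply/bigcupP => -[i _ /imsetP [j _ /eqP]].
  by rewrite eq_sym mulf_eq0 !expf_eq0 (negPf w0) !andbF.
have D0 : 0 \notin D.
  apply/bigcupP => -[i _ /imsetP [j _ /eqP]].
  by rewrite eq_sym mulf_eq0 !expf_eq0 (negPf g0) !andbF.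
have gammaP (x : K) : x != 0 -> exists k, x = gamma ^+ k.
  move=> x0; have [|k ->] := prim_rootP gamma_prim (x := x); last by exists k.
  apply: (mulIf x0); rewrite mul1r -exprSr subn1 prednK ?expn_gt0 ?q_gt0 //.
  by rewrite -cardK expf_card.
(* The norm sends [gamma ^+ k] to [omega ^+ k], so its values do lie in [F]; by the exponent
   criterion, [D] is the preimage of [E]. *)
have [N NE] : exists N : restriction iota -> F,
    forall x, iota (N x) = (x : K) ^+ (#|F| + 1).
  suff h (x : K) : exists c, iota c = x ^+ (#|F| + 1).
    by have [N NE] := fin_all_exists h; exists N.
  rewrite cardF.
  have [->|/gammaP [k ->]] := eqVneq x 0.
    by exists 0; rewrite rmorph0 expr0n addn1.
  by exists (omega ^+ k); rewrite rmorphXn /= omega_norm exprAC.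
have DE (x : restriction iota) : (x \in D) = (N x \in E).
  have [->|/gammaP [k xE]] := eqVneq x 0.
    by rewrite (quadratic0 (norm_quadratic NE)) (negPf E0) (negPf D0).
  have -> : N x = omega ^+ k.
    by apply: (fmorph_inj iota); rewrite NE xE rmorphXn /= omega_norm exprAC cardF.
  by rewrite xE memE memD.
have cardK' : #|K| = (#|F| ^ 2)%N by rewrite cardF.
have quadN := norm_quadratic NE; have ndN := norm_nondegenerate NE cardK'.
have [n [r [v [k [lam [mu [srgD vE kE _ muE]]]]]]] := nlst.
(* The order gives [n = q]; comparing valencies, [#|E| * (q + 1) = r * (n + 1)], then gives
   [r = #|E|]. *)
have nq : n = q.
  apply/eqP; rewrite -(eqn_exp2r _ _ (isT : 0 < 2)%N) -vE -cardK eq_sym.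
  by rewrite (srg_order srgD).
have rE : r = #|E|.
  have := srg_valency srgD 0; rewrite (card_cayley_neighbours quadN DE).
  rewrite (norm_level_card NE) // kE nq cardF => /eqP.
  by rewrite eqn_pmul2r ?addn1 // eq_sym => /eqP.
have commonN x y :
    #|[set z | cayley D x z && cayley D y z]| = common_count E N (x - y : K).
  exact: (card_cayley_common DE).
(* Every nonzero scalar is a norm, so the parameters of the given graph yield the root counts
   through [norm_common_count]. *)
have rc_lam : {in E, forall c, root_count E c = (2 * #|E| ^ 2 - lam)%N}.
  move=> c cE; have c0 : c != 0 by apply: contraNneq E0 => <-.
  have [u Nu] := level_gt0 quadN ndN (m := 1) cardK' isT c0.
  have u0 : u != 0 by apply: contraNneq c0 => u0; rewrite -Nu u0 (quadratic0 quadN).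
  have := norm_common_count NE cardK' E u0; rewrite Nu => <-.
  have uD : cayley D u 0 by rewrite /cayley subr0 DE Nu.
  by rewrite -(srg_adjacent srgD uD) commonN subr0 addKn.
have rc_mu c : c \notin E -> root_count E c = (2 * #|E| ^ 2 - mu)%N.
  have [->|c0] := eqVneq c 0.
    (* Here [#|E| ^ 2 - #|E| = 2 * #|E| ^ 2 - mu], by the value of [mu]. *)
    by move=> _; have := root_count0 E0; rewrite muE rE; lia.
  have [u Nu] := level_gt0 quadN ndN (m := 1) cardK' isT c0.
  have u0 : u != 0 by apply: contraNneq c0 => u0; rewrite -Nu u0 (quadratic0 quadN).
  move=> cE; have := norm_common_count NE cardK' E u0; rewrite Nu => <-.
  have uD : ~~ cayley D u 0 by rewrite /cayley subr0 DE Nu.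
  by rewrite -(srg_nonadjacent srgD u0 uD) commonN subr0 addKn.
have exE : exists c, c \in E.
  by have [x [y]] := srg_not_edgeless srgD; rewrite /cayley DE; exists (N (x - y : K)).
have exE' : exists2 c, c != 0 & c \notin E.
  have [x [y [nxy]]] := srg_not_complete srgD; rewrite /cayley DE => xyE.
  exists (N (x - y : K)) => //; apply: contraNneq nxy => /(norm_eq0 NE) xy0.
  by rewrite -subr_eq0; apply/eqP.
move=> m Q m_gt0 formQ nsQ; have quadQ := quadratic_form_map formQ.
have cardV : #|{: 'rV[F]_(2 * m)}| = (#|F| ^ (2 * m))%N by rewrite card_mx mul1n.
have ndQ : nondegenerate_on Q [set: 'rV[F]_(2 * m)].
  apply: (nondegenerate_even quadQ cardV) => u; apply: nonsingular_radical => //.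
  by rewrite muln_gt0.
apply: (strongly_regular_of_root_count quadQ _ E0 exE exE' ndQ cardV m_gt0
  rc_lam rc_mu).
by move=> u; rewrite inE.
Qed.
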